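(* Let $a,b\in R^{WD}$, and let $a^{WD}$, $b^{WD}$ be WD inverses of $a$ and $b$ respectively. If $ab=ba$ and $b^{WD}ba=ab^{WD}b$, then $ab$ is WD invertible and $a^{WD}b^{WD}$ is a WD inverse of $ab$, i.e. $(ab)^{WD}=a^{WD}b^{WD}$.
   Context: $R$ is a proper unital ring with involution: an associative ring with $1$ and a map $*:R\to R$ with $(a+b)^*=a^*+b^*$, $(ab)^*=b^*a^*$, $(a^* )^*=a$, such that $a^*a=0$ implies $a=0$. Weak Drazin (WD) inverse: $a\in R$ is WD invertible if there are $x\in R$ and a positive integer $k$ with $axa=a$, $a^{k+1}x=a^k$, $xa^{k+1}=a^k$. The least positive integer $k$ for which such an $x$ exists is the weak Drazin index $\mathrm{ind}(a)$; any $x$ satisfying the three equations with $k=\mathrm{ind}(a)$ is a WD inverse of $a$ (not unique in general), denoted $a^{WD}$. $R^{WD}$ is the set of WD invertible elements. *)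

(* Defs.v *)
From mathcomp Require Import all_boot all_order all_algebra.

Set Implicit Arguments.
Unset Strict Implicit.
Unset Printing Implicit Defensive.

Import GRing.Theory.
Local Open Scope ring_scope.

(* Rings are [pzRingType]: associative and unital, with 1 = 0 allowed. *)

Record proper_involution (R : pzRingType) (star : R -> R) : Prop :=
  ProperInvolution {
    starD : {morph star : a b / a + b};
    starM : forall a b : R, star (a * b) = star b * star a;
    starK : involutive star;
    star_proper : forall a : R, star a * a = 0 -> a = 0
  }.

Definition wd_equations (R : pzRingType) (k : nat) (a x : R) : Prop :=
  [/\ a * x * a = a, a ^+ k.+1 * x = a ^+ k & x * a ^+ k.+1 = a ^+ k].

Definition wd_invertible (R : pzRingType) (a : R) : Prop :=
  exists (x : R) (k : nat), (0 < k)%N /\ wd_equations k a x.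

(* The index is a relation because it exists only for WD invertible elements;
   by minimality at most one [k] satisfies it. *)
Definition is_wd_index (R : pzRingType) (a : R) (k : nat) : Prop :=
  [/\ (0 < k)%N, exists x : R, wd_equations k a x &
      forall m : nat, (0 < m)%N ->
        (exists x : R, wd_equations m a x) -> (k <= m)%N].

Definition is_wd_inverse (R : pzRingType) (a x : R) : Prop :=
  exists2 k : nat, is_wd_index a k & wd_equations k a x.

(* Main.v *)
(* With [x], [y] WD inverses of [a], [b], direct computation shows that [x * y]
   satisfies the equations for [a * b] with exponent [maxn k l], where [k], [l]
   are the indices of [a], [b]. The index [m] of [a * b] may be smaller, but if
   [z] satisfies the equations with exponent [m] then
   [c ^+ m = z ^+ j * c ^+ (m + j) = c ^+ (m + j) * z ^+ j] for [c := a * b], so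
   any solution at a larger exponent is also a solution at exponent [m]. *)
Require Import Defs.
From mathcomp Require Import all_boot all_order all_algebra.
From mathcomp Require Import boolp.

Import GRing.Theory.
Local Open Scope ring_scope.

Section WeakDrazin.
Variable R : pzRingType.
Implicit Types (a b x y z : R) (k m n : nat).

Lemma wd_equations_leq {k n a x} :
  (k <= n)%N -> wd_equations k a x -> wd_equations n a x.
Proof.
move=> le_kn [axa axr axl]; split=> //; rewrite -(subnK le_kn).
  by rewrite -addnS exprD -mulrA axr -exprD.
by rewrite addnC -addSn exprD mulrA axl -exprD.
Qed.

(** Each factor [z] cancels one factor [a], because the equations persist at every exponent [j + m]
    above [m]. *)
Lemma wd_equations_exprl {m a z} j :
  wd_equations m a z -> z ^+ j * a ^+ (j + m) = a ^+ m.
Proof.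
move=> eqz; elim: j => [|j IHj]; first by rewrite mul1r.
have [_ _ zl] := wd_equations_leq (leq_addl j m) eqz.
by rewrite exprSr -mulrA addSn zl.
Qed.

Lemma wd_equations_exprr {m a z} j :
  wd_equations m a z -> a ^+ (j + m) * z ^+ j = a ^+ m.
Proof.
move=> eqz; elim: j => [|j IHj]; first by rewrite mulr1.
have [_ zr _] := wd_equations_leq (leq_addl j m) eqz.
by rewrite exprS mulrA addSn zr.
Qed.

Lemma wd_equations_lower {m n a x z} : (m <= n)%N ->
  wd_equations m a z -> wd_equations n a x -> wd_equations m a x.
Proof.
move=> le_mn eqz [axa xr xl].
have zl := wd_equations_exprl (n - m) eqz; rewrite subnK // in zl.
have zr := wd_equations_exprr (n - m) eqz; rewrite subnK // in zr.
(* Expanding [a ^+ m] by [zl] creates the power [a ^+ n.+1] on which [xr] can act; [zl] then folds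
   the result back. *)
split=> //; first by rewrite exprSr -{1}zl -(mulrA (z ^+ _)) -exprSr -mulrA xr.
by rewrite exprS -{1}zr (mulrA a) -exprS mulrA xl.
Qed.

Lemma wd_index_exists a : wd_invertible a -> exists k, is_wd_index a k.
Proof.
case=> x [k [k_gt0 eqx]].
(* Classical reflection makes the predicate boolean, so that a least exponent can be chosen. *)
have exP : exists n, `[< (0 < n)%N /\ exists x, wd_equations n a x >].
  by exists k; apply/asboolP; split=> //; exists x.
case: (ex_minnP exP) => m /asboolP[m_gt0 exm] min_m; exists m.
by split=> // n n_gt0 exn; apply/min_m/asboolP.
Qed.

(** Dispenses with computing the index: any positive exponent that works bounds it from above, so
    the equations can be lowered to it. *)
Lemma wd_equations_inverse n a x :
  (0 < n)%N -> wd_equations n a x -> is_wd_inverse a x.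
Proof.
move=> n_gt0 eqx.
have [m ind_m] : exists m, is_wd_index a m.
  by apply: wd_index_exists; exists x, n.
exists m => //; case: ind_m => _ [z eqz] min_m.
by apply: (wd_equations_lower _ eqz eqx); apply: min_m => //; exists x.
Qed.

Lemma wd_equations_mul n a b x y : GRing.comm a b ->
    y * b * a = a * y * b ->
  wd_equations n a x -> wd_equations n b y -> wd_equations n (a * b) (x * y).
Proof.
move=> cab yba [axa xr xl] [byb yr yl].
have cX i j : a ^+ i * b ^+ j = b ^+ j * a ^+ i.
  exact/commrX/commr_sym/commrX/commr_sym.
split.
- transitivity (b * (a * x * (y * b * a))); first by rewrite {1 2}cab !mulrA.
  (* [yba] is used both ways: forward to form [a * x * a], then backward to form [b * y * b]. *)
  by rewrite yba !(mulrA (a * x)) axa -yba !mulrA byb cab.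
(* Swapping the commuting powers puts [a ^+ n.+1] next to [x]; swapping back puts [b ^+ n.+1] next
   to [y]. *)
- rewrite !exprMn_comm // cX mulrA -(mulrA _ _ x) xr -cX.
  by rewrite -mulrA yr.
- rewrite !exprMn_comm // cX -mulrA (mulrA y) yl -cX.
  by rewrite mulrA xl.
Qed.

End WeakDrazin.

Theorem theorem3p4 (R : pzRingType) (star : R -> R)
    (Hstar : proper_involution star)
    (a b aWD bWD : R)
    (Ha : wd_invertible a) (Hb : wd_invertible b)
    (HaWD : is_wd_inverse a aWD) (HbWD : is_wd_inverse b bWD)
    (Hab : a * b = b * a)
    (Hba : bWD * b * a = a * bWD * b) :
  wd_invertible (a * b) /\ is_wd_inverse (a * b) (aWD * bWD).
Proof.
case: HaWD HbWD => [k [k_gt0 _ _] eqa] [l _ eqb].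
have n_gt0 : (0 < maxn k l)%N by rewrite leq_max k_gt0.
have eqab : wd_equations (maxn k l) (a * b) (aWD * bWD).
  apply: wd_equations_mul => //.
    exact: wd_equations_leq (leq_maxl k l) eqa.
  exact: wd_equations_leq (leq_maxr k l) eqb.
split; first by exists (aWD * bWD), (maxn k l).
exact: wd_equations_inverse n_gt0 eqab.
Qed.
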